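(* Let $M\subset\mathbb{Z}^d$ be a positive affine monoid such that the group $\operatorname{gp}(M)$ generated by $M$ equals $\mathbb{Z}^d$. If $M$ satisfies the integral Carath\'eodory property (ICP), then $M=\mathbb{R}_+M\cap\mathbb{Z}^d$, and every element of $M$ is $f$-covered, i.e. every $x\in M$ can be written as $x=a_1y_1+\dots+a_dy_d$ with $a_1,\dots,a_d\in\mathbb{Z}_{\ge 0}$ and $y_1,\dots,y_d\in\operatorname{Hilb}(M)$ linearly independent.
   Context: An affine monoid is a finitely generated submonoid of $\mathbb{Z}^d$; it is positive if $0$ is its only invertible element. $\operatorname{Hilb}(M)$ is the unique minimal generating set of $M$, consisting of the nonzero elements of $M$ that cannot be written as $x+y$ with $x,y\in M\setminus\{0\}$. $M$ satisfies (ICP) if every element of $M$ can be written as $a_1x_1+\dots+a_dx_d$ with $x_i\in\operatorname{Hilb}(M)$ and $a_i\in\mathbb{Z}_{\ge0}$ (at most $d$ elements of the Hilbert basis, with nonnegative integer coefficients). $\mathbb{R}_+M$ denotes the cone of nonnegative real linear combinations of elements of $M$. *)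

(* Defs.v *)
From HB Require Import structures.
From mathcomp Require Import all_boot all_order all_algebra.
From mathcomp Require Import reals.
Set Implicit Arguments. Unset Strict Implicit. Unset Printing Implicit Defensive.
Import Order.TTheory GRing.Theory Num.Theory.
Local Open Scope ring_scope.

Definition zset (d : nat) := 'rV[int]_d -> Prop.

Definition affine_monoid (d : nat) (M : zset d) : Prop :=
  exists gens : seq 'rV[int]_d,
    forall x, M x <-> exists c : 'I_(size gens) -> nat,
                      x = \sum_(i < size gens) gens`_i *+ c i.

Definition positive_monoid (d : nat) (M : zset d) : Prop :=
  forall x, M x -> M (- x) -> x = 0.

Definition in_gp (d : nat) (M : zset d) (x : 'rV[int]_d) : Prop :=
  exists (n : nat) (s : 'I_n -> 'rV[int]_d) (c : 'I_n -> int),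
    (forall i, M (s i)) /\ x = \sum_(i < n) s i *~ c i.

Definition gp_full (d : nat) (M : zset d) : Prop := forall x, in_gp M x.

Definition in_hilb (d : nat) (M : zset d) (x : 'rV[int]_d) : Prop :=
  M x /\ x != 0 /\
  ~ (exists y z, M y /\ M z /\ y != 0 /\ z != 0 /\ x = y + z).

Definition ICP (d : nat) (M : zset d) : Prop :=
  forall x, M x -> exists (a : 'I_d -> nat) (y : 'I_d -> 'rV[int]_d),
    (forall i, in_hilb M (y i)) /\ x = \sum_(i < d) y i *+ a i.

Definition rvR (R : realType) (d : nat) (x : 'rV[int]_d) : 'rV[R]_d :=
  map_mx (fun z : int => z%:~R) x.

Definition in_cone (R : realType) (d : nat) (M : zset d) (x : 'rV[int]_d) : Prop :=
  exists (n : nat) (s : 'I_n -> 'rV[int]_d) (r : 'I_n -> R),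
    (forall i, M (s i)) /\ (forall i, 0 <= r i) /\
    rvR R x = \sum_(i < n) r i *: rvR R (s i).

Definition f_covered (R : realType) (d : nat) (M : zset d) (x : 'rV[int]_d) : Prop :=
  exists (a : 'I_d -> nat) (y : 'I_d -> 'rV[int]_d),
    (forall i, in_hilb M (y i)) /\
    row_free (\matrix_(i < d, j < d) ((y i) ord0 j)%:~R : 'M[R]_d) /\
    x = \sum_(i < d) y i *+ a i.

(* Main.v *)
(** Let [x] be in the cone and write [x = m1 - m2] with [m1], [m2] in [M]. Let [D > 0] be a
    common multiple of the nonzero determinants of [d]-tuples of generators. For large [k],
    [z = x + D (m + m2 + t g)] lies in [M], where [m] in [M] rounds down [k x] and the small
    multiple [t g] of a generic [g] in [M] moves [z] off the finitely many hyperplanes spanned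
    by generators. Hence (ICP) writes [z] through linearly independent [y_1, ..., y_d]. Since
    [D] annihilates [Z^d / <y_1, ..., y_d>], [x] is an integral combination of the [y_i]; since
    [z / (D k)] is close to [x], its coefficients are nonnegative. *)

Require Import Defs.
From HB Require Import structures.
From mathcomp Require Import all_boot all_order all_algebra.
From mathcomp Require Import reals lra.
Set Implicit Arguments.
Unset Strict Implicit.
Import Order.TTheory GRing.Theory Num.Theory.
Local Open Scope ring_scope.

(** * Affine monoids, differences of their elements, and finiteness of the Hilbert basis *)

Section AffineMonoid.
Variables (d : nat) (M : zset d).
Hypothesis affM : affine_monoid M.

Lemma affine_monoid0 : M 0.
Proof.
have [gens gensP] := affM; apply/gensP; exists (fun=> 0%N).
by rewrite big1.
Qed.

Lemma affine_monoidD x y : M x -> M y -> M (x + y).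
Proof.
have [gens gensP] := affM => /gensP[a ->] /gensP[b ->]; apply/gensP.
exists (fun i => a i + b i)%N; rewrite -big_split /=.
by apply: eq_bigr => i _; rewrite mulrnDr.
Qed.

Lemma affine_monoidMn x n : M x -> M (x *+ n).
Proof.
move=> Mx; elim: n => [|n IHn]; first exact: affine_monoid0.
by rewrite mulrS; apply: affine_monoidD.
Qed.

Lemma affine_monoid_sum (I : finType) (s : I -> 'rV[int]_d) (a : I -> nat) :
  (forall i, M (s i)) -> M (\sum_i s i *+ a i).
Proof.
move=> Ms; apply: (big_ind M); first exact: affine_monoid0.
- exact: affine_monoidD.
- by move=> i _; apply: affine_monoidMn.
Qed.

Lemma in_gp_sub x : in_gp M x -> exists m1 m2, [/\ M m1, M m2 & x = m1 - m2].
Proof.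
case=> n [s [c [Ms ->]]].
pose K v := exists m1 m2, [/\ M m1, M m2 & v = m1 - m2].
apply: (big_ind K).
- by exists 0, 0; split; rewrite ?subr0 //; apply: affine_monoid0.
- move=> _ _ [a [b [Ma Mb ->]]] [a' [b' [Ma' Mb' ->]]].
  exists (a + a'), (b + b'); split; try exact: affine_monoidD.
  by rewrite opprD addrACA.
- move=> i _; case: (c i) => m.
    exists (s i *+ m), 0; split; rewrite ?subr0 //; last exact: affine_monoid0.
    exact: affine_monoidMn.
  exists 0, (s i *+ m.+1); split; rewrite ?sub0r //; first exact: affine_monoid0.
  exact: affine_monoidMn.
Qed.

(** Split one generator off a nonzero term of a combination equal to [x]: irreducibility forces the
    remainder to vanish, so [x] is that generator. *)
Lemma in_hilb_gens : exists gens : seq 'rV[int]_d,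
  forall x, in_hilb M x -> x \in gens.
Proof.
have [gens gensP] := affM; exists gens => x [/gensP[c xE] [x0 xirr]].
have Mg i : (i < size gens)%N -> M gens`_i.
  move=> ltig; apply/gensP; exists (fun j => (j == Ordinal ltig) : nat).
  rewrite (bigD1 (Ordinal ltig)) //= eqxx mulr1n big1 ?addr0 // => j /negPf ->.
  by rewrite mulr0n.
have [i /eqP ci0|c0] := pickP (fun i : 'I_(size gens) => gens`_i *+ c i != 0); last first.
  by case/eqP: x0; rewrite xE big1 // => i _; apply/eqP; rewrite -[_ == _]negbK c0.
have [ci gi0] : (0 < c i)%N /\ gens`_i != 0.
  split; first by rewrite lt0n; apply/eqP => c0; apply: ci0; rewrite c0.
  by apply/eqP => g0; apply: ci0; rewrite g0 mul0rn.
pose y := gens`_i *+ (c i).-1 + \sum_(j < size gens | j != i) gens`_j *+ c j.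
have xD : x = gens`_i + y.
  by rewrite /y addrA -mulrS prednK // xE (bigD1 i).
have My : M y.
  apply: affine_monoidD; first exact/affine_monoidMn/Mg.
  apply: (big_ind M); first exact: affine_monoid0.
  - exact: affine_monoidD.
  - by move=> j _; apply/affine_monoidMn/Mg.
have [y0|y0] := eqVneq y 0; first by rewrite xD y0 addr0 mem_nth.
by case: xirr; exists gens`_i, y; split; [exact: Mg|].
Qed.

End AffineMonoid.

(** * Real linear functionals on lattice points *)

Section Functionals.
Variables (R : realType) (d : nat).

Definition rvdot (u : 'cV[R]_d) (x : 'rV[int]_d) : R := (rvR R x *m u) 0 0.

Lemma rvdotE u x : rvdot u x = \sum_j (x 0 j)%:~R * u j 0.
Proof. by rewrite /rvdot mxE; apply: eq_bigr => j _; rewrite mxE. Qed.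

Lemma rvdot_is_zmod_morphism u : zmod_morphism (rvdot u).
Proof.
move=> x y; rewrite !rvdotE -sumrB; apply: eq_bigr => j _.
by rewrite !mxE intrB mulrBl.
Qed.

HB.instance Definition _ u :=
  GRing.isZmodMorphism.Build _ _ (rvdot u) (rvdot_is_zmod_morphism u).

Lemma rvdot_comb u x n (s : 'I_n -> 'rV[int]_d) (r : 'I_n -> R) :
  rvR R x = \sum_(i < n) r i *: rvR R (s i) ->
  rvdot u x = \sum_(i < n) r i * rvdot u (s i).
Proof.
rewrite /rvdot => ->; rewrite mulmx_suml summxE; apply: eq_bigr => i _.
by rewrite -scalemxAl mxE.
Qed.

(** A nonzero [u] is nonzero on some unit vector, which is an integral combination of elements of
    [M]. *)
Lemma rvdot_neq0 (M : zset d) u :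
  gp_full M -> u != 0 -> exists2 s, M s & rvdot u s != 0.
Proof.
move=> gpM /cV0Pn[j uj].
have [n [s [c [Ms sE]]]] := gpM (delta_mx 0 j).
have [i si|s0] := pickP (fun i => rvdot u (s i) != 0); first by exists (s i).
case/eqP: uj; transitivity (rvdot u (delta_mx 0 j)).
  rewrite rvdotE (bigD1 j) //= mxE !eqxx mul1r big1 ?addr0 // => k /negPf kj.
  by rewrite mxE kj andbF mul0r.
rewrite sE raddf_sum big1 // => i _; rewrite raddfMz /=.
by have /negbFE/eqP -> := s0 i; rewrite mul0rz.
Qed.

End Functionals.

(* Each nonzero affine function has at most one root. *)
Lemma avoid_affine_roots (F : numDomainType) (I : finType) (a b : I -> F) :
  exists2 t, (t <= #|I|)%N &
    forall i, (a i != 0) || (b i != 0) -> a i + b i *+ t != 0.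
Proof.
pose bad (t : 'I_#|I|.+1) i := ((a i != 0) || (b i != 0)) && (a i + b i *+ t == 0).
have [t tgood|allbad] := pickP (fun t => [forall i, ~~ bad t i]).
  exists t => [|i nz]; first by rewrite -ltnS.
  by have /forallP/(_ i) := tgood; rewrite /bad nz.
(* Pigeonhole: if all [#|I|.+1] values of [t] were bad, choosing for each a function that vanishes
   there would be injective into [I]. *)
have /fin_all_exists[f fbad] t : exists i, bad t i.
  by have /negbT := allbad t; rewrite negb_forall => /existsP[i]; rewrite negbK; exists i.
suff /leq_card : injective f by rewrite card_ord ltnn.
move=> t t' ftt'; apply/val_inj => /=; have := fbad t'; have := fbad t; rewrite -ftt'.
move=> /andP[nz /eqP at0] /andP[_ /eqP at0'].
have b0 : b (f t) != 0.
  by apply: contraTneq nz => b0; move: at0; rewrite b0 mul0rn addr0 => ->; rewrite eqxx.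
have /eqP : b (f t) *+ t = b (f t) *+ t' by apply: (addrI (a (f t))); rewrite at0 at0'.
rewrite -[_ *+ t]mulr_natl -[_ *+ t']mulr_natl => /eqP/(mulIf b0)/eqP.
by rewrite eqr_nat => /eqP.
Qed.

Lemma exists_generic (R : realType) (d : nat) (M : zset d) (us : seq 'cV[R]_d) :
  affine_monoid M -> gp_full M ->
  exists2 g, M g & forall u, u \in us -> u != 0 -> rvdot u g != 0.
Proof.
move=> affM gpM; elim: us => [|v us [g Mg gP]]; first by exists 0; first exact: affine_monoid0.
have [v0|v0] := eqVneq v 0.
  exists g => // u; rewrite inE => /orP[/eqP -> /eqP//|]; exact: gP.
have [s Ms sv] := rvdot_neq0 gpM v0.
(* Along [g + t s] the new functional [v] has nonzero slope, and the earlier nonzero ones have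
   nonzero constant term. *)
have [t _ tP] := avoid_affine_roots
  (fun i : 'I_(size (v :: us)) => rvdot (v :: us)`_i g) (fun i => rvdot (v :: us)`_i s).
exists (g + s *+ t) => [|u uin u0].
  by apply: affine_monoidD => //; apply: affine_monoidMn.
have ltus : (index u (v :: us) < size (v :: us))%N by rewrite index_mem.
have := tP (Ordinal ltus); rewrite [X in rvdot X]nth_index // raddfD raddfMn; apply.
move: uin; rewrite inE => /orP[/eqP ->|uin]; first by rewrite sv orbT.
by rewrite gP.
Qed.

(** * Tuples of [d] lattice vectors: coordinates, Cramer's rule and rounding *)

Section Tuples.
Variables (R : realType) (d : nat).
Implicit Type y : 'I_d -> 'rV[int]_d.

Definition tuple_mx y : 'M[int]_d := \matrix_(i < d) y i.

Lemma det_tuple_mxR y :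
  \det (map_mx intr (tuple_mx y) : 'M[R]_d) = (\det (tuple_mx y))%:~R.
Proof. exact: det_map_mx. Qed.

Lemma row_tuple_mxR y i : row i (map_mx intr (tuple_mx y)) = rvR R (y i).
Proof. by apply/rowP => j; rewrite !mxE. Qed.

(** The dual basis of [y]. For a singular tuple [invmx] returns the matrix itself, so duality needs
    a nonzero determinant. *)
Definition dual_functional y i : 'cV[R]_d := col i (invmx (map_mx intr (tuple_mx y))).

Lemma dual_functionalE y i j : \det (tuple_mx y) != 0 ->
  rvdot (dual_functional y i) (y j) = (j == i)%:R.
Proof.
move=> dety.
have yV : map_mx intr (tuple_mx y) \in @unitmx R d.
  by rewrite unitmxE det_tuple_mxR unitfE intr_eq0.
rewrite /rvdot -row_tuple_mxR; transitivity ((1%:M : 'M[R]_d) j i); last by rewrite mxE.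
by rewrite -(mulmxV yV) !mxE; apply: eq_bigr => k _; rewrite !mxE.
Qed.

Lemma dual_functional_comb y i x (b : 'I_d -> int) : \det (tuple_mx y) != 0 ->
  x = \sum_j y j *~ b j -> rvdot (dual_functional y i) x = (b i)%:~R.
Proof.
move=> dety ->; rewrite raddf_sum (bigD1 i) //= raddfMz /= dual_functionalE // eqxx.
rewrite big1 ?addr0 // => j /negPf ji.
by rewrite raddfMz /= dual_functionalE // ji mul0rz.
Qed.

Lemma exists_annihilator y : \det (tuple_mx y) = 0 ->
  exists2 u : 'cV[R]_d, u != 0 & forall i, rvdot u (y i) = 0.
Proof.
move=> dety; have : \det (map_mx intr (tuple_mx y) : 'M[R]_d)^T == 0.
  by rewrite det_tr det_tuple_mxR dety.
move=> /det0P[v v0 vy]; exists v^T => [|i].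
  by apply: contraNneq v0 => /(congr1 trmx); rewrite trmxK trmx0 => ->.
rewrite /rvdot -row_tuple_mxR -row_mul -[_ *m _]trmxK trmx_mul trmxK vy.
by rewrite !mxE.
Qed.

(** Cramer's rule: the adjugate supplies integral coefficients for the determinant times [w], and
    [q] scales them up to [D]. *)
Lemma tuple_lattice y (D : nat) w : (\det (tuple_mx y) %| D%:Z)%Z ->
  exists c : 'I_d -> int, w *+ D = \sum_i y i *~ c i.
Proof.
move=> /dvdzP[q Dq]; pose v := q *: (w *m \adj (tuple_mx y)).
exists (v 0); transitivity (v *m tuple_mx y).
  rewrite -scalemxAl -mulmxA mul_adj_mx mul_mx_scalar scalerA -Dq.
  by apply/rowP => j; rewrite !mxE mulmxnE pmulrn -mulrzl intz.
rewrite mulmx_sum_row; apply: eq_bigr => i _.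
by rewrite rowK -scaler_int intz.
Qed.

(** Truncation changes each coefficient by at most 1, so the error bound does not depend on [k]. *)
Lemma rvdot_round_le (u : 'cV[R]_d) x n (s : 'I_n -> 'rV[int]_d) (r : 'I_n -> R) k :
  (forall i, 0 <= r i) -> rvR R x = \sum_(i < n) r i *: rvR R (s i) ->
  rvdot u (\sum_(i < n) s i *+ Num.truncn (k%:R * r i)) <=
    k%:R * rvdot u x + \sum_(i < n) `|rvdot u (s i)|.
Proof.
move=> r0 /(rvdot_comb u) ->; rewrite raddf_sum mulr_sumr -big_split /=.
apply: ler_sum => i _; rewrite raddfMn /= -[_ *+ Num.truncn _]mulr_natl mulrA -lerBlDl -mulrBl.
apply: le_trans (ler_norm _) _; rewrite normrM ler_piMl //.
have /andP[] := truncn_itv (mulr_ge0 (ler0n R k) (r0 i)).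
by rewrite -natr1 ler_norml => *; apply/andP; split; lra.
Qed.

End Tuples.

(** Starting from the cone rather than from [M] gives both conclusions at once, since an [f]-covered
    element lies in [M]. *)
Lemma cone_f_covered (R : realType) (d : nat) (M : zset d) x :
  affine_monoid M -> gp_full M -> ICP M -> in_cone R M x -> f_covered R M x.
Proof.
move=> affM gpM icpM [n [s [r [Ms [r0 xE]]]]].
have [gens hilb_gens] := in_hilb_gens affM.
have [m1 [m2 [Mm1 Mm2 xm]]] := in_gp_sub affM (gpM x).
pose I := {ffun 'I_d -> 'I_(size gens)}.
pose Y (h : I) i := gens`_(h i).
have /fin_all_exists[u uP] (h : I) : exists u : 'cV[R]_d,
    \det (tuple_mx (Y h)) = 0 -> u != 0 /\ forall i, rvdot u (Y h i) = 0.
  have [/(exists_annihilator R)[u u0 uY]|/eqP] := eqVneq (\det (tuple_mx (Y h))) 0.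
    by exists u.
  by exists 0.
have [g Mg gP] := exists_generic (codom u) affM gpM.
(* The [maxn 1] keeps singular tuples from making the product zero. *)
pose D := (\prod_(h : I) maxn 1 `|\det (tuple_mx (Y h))|)%N.
have D0 : (0 < D)%N by apply: prodn_gt0 => h; rewrite leq_max.
have detD h : \det (tuple_mx (Y h)) != 0 -> (\det (tuple_mx (Y h)) %| D%:Z)%Z.
  move=> dety; rewrite dvdzE absz_nat /D (bigD1 h) //= (maxn_idPr _) ?dvdn_mulr //.
  by rewrite absz_gt0.
(* Bounds the rounding error, [m2] and the perturbation together. The last term uses only
   [t <= #|I|], so [k] can be fixed before [t], which depends on [k] through [m]. *)
pose C h i := let f := dual_functional R (Y h) i in
  \sum_j `|rvdot f (s j)| + `|rvdot f m2| + #|I|%:R * `|rvdot f g|.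
have C0 h i : 0 <= C h i by rewrite !addr_ge0 ?sumr_ge0 ?mulr_ge0.
pose k := (Num.truncn (\sum_h \sum_i C h i)).+1.
have Ck h i : C h i <= k%:R.
  apply: le_trans (ltW (truncnS_gt _)).
  rewrite (bigD1 h) //= (bigD1 i) //= -addrA lerDl addr_ge0 ?sumr_ge0 // => h' _.
  exact: sumr_ge0.
pose m := \sum_j s j *+ Num.truncn (k%:R * r j).
have [t leI tP] := avoid_affine_roots
  (fun h => rvdot (u h) (x + (m + m2) *+ D)) (fun h => rvdot (u h) (g *+ D)).
pose w := m + m2 + g *+ t.
have Mz : M (x + w *+ D).
  (* As [D > 0], one of the [D] copies of [m2] cancels the negative part of [x = m1 - m2]. *)
  have -> : x + w *+ D = m1 + ((m + g *+ t) *+ D + m2 *+ D.-1).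
    have m2D : m2 *+ D = m2 + m2 *+ D.-1 by rewrite -mulrS prednK.
    rewrite xm /w !mulrnDl m2D -addrA [_ + _ + g *+ _ *+ _]addrAC.
    by congr (_ + _); rewrite addrCA addKr.
  do ![apply: affine_monoidD => // | apply: affine_monoidMn => //].
  exact: affine_monoid_sum.
have [a [y [hilby zE]]] := icpM _ Mz.
have yin i : (index (y i) gens < size gens)%N by rewrite index_mem hilb_gens.
pose h : I := [ffun i => Ordinal (yin i)].
have Yy i : Y h i = y i by rewrite /Y ffunE /= nth_index // hilb_gens.
have dety : \det (tuple_mx (Y h)) != 0.
  (* Otherwise [u h] would kill every [y i], hence [x + w *+ D], against the choice of [t]; the
     slope is nonzero because [g] is generic. *)
  apply/eqP => dety; have [u0 uY] := uP h dety.
  have : rvdot (u h) (g *+ D) != 0.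
    by rewrite raddfMn mulrn_eq0 negb_or -lt0n D0 gP ?codom_f.
  move=> /(fun gD => tP h (introT orP (or_intror gD)))/eqP; apply.
  rewrite -raddfMn -raddfD mulrnAC -addrA -mulrnDl -/w zE raddf_sum big1 // => i _.
  by rewrite -Yy raddfMn /= uY mul0rn.
have [c wE] := tuple_lattice w (detD h dety).
have xb : x = \sum_i Y h i *~ ((a i)%:Z - c i).
  rewrite -(addrK (w *+ D) x) zE wE -sumrB; apply: eq_bigr => i _.
  by rewrite Yy mulrzBr.
have b0 i : 0 <= (a i)%:Z - c i.
  (* A negative integer [b] is at most -1, so [f] is at most [k b + k <= 0] on [w] and negative on
     [x + w *+ D], where its value is [a i >= 0]. *)
  set b := (X in 0 <= X); rewrite leNgt; apply/negP => b_lt0.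
  pose f := dual_functional R (Y h) i.
  have fx : rvdot f x = b%:~R := dual_functional_comb R i dety xb.
  clearbody b.
  have fz : rvdot f (x + w *+ D) = (a i)%:R.
    have zE' : x + w *+ D = \sum_j Y h j *~ (a j)%:Z.
      by rewrite zE; apply: eq_bigr => j _; rewrite Yy.
    by rewrite [LHS](dual_functional_comb R i dety zE').
  have b_le : b%:~R <= (-1)%:~R :> R by rewrite ler_int -ltzD1 addNr.
  have fm := rvdot_round_le f k r0 xE.
  have fm2 := ler_norm (rvdot f m2).
  have fg : rvdot f g *+ t <= #|I|%:R * `|rvdot f g|.
    rewrite -[_ *+ t]mulr_natl (le_trans (ler_norm _)) // normrM ler_wpM2r // normr_nat.
    by rewrite ler_nat.
  have := Ck h i; rewrite /C -/f => Chi.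
  have : rvdot f w <= k%:R * b%:~R + k%:R.
    by rewrite fx -/m in fm; rewrite /w !raddfD raddfMn /=; lra.
  have : 0 <= rvdot f (x + w *+ D) by rewrite fz.
  rewrite raddfD raddfMn /= fx leNgt => /negP + fw; apply.
  have /(mulrn_wle0 D) fwD : rvdot f w <= 0.
    by apply: le_trans fw _; rewrite -[X in _ + X]mulr1 -mulrDr mulr_ge0_le0 //; lra.
  lra.
exists (fun i => `|(a i)%:Z - c i|%N), y; split=> //; split.
  rewrite row_free_unit unitmxE unitfE.
  rewrite (_ : \matrix_(_, _) _ = map_mx intr (tuple_mx (Y h))).
    by rewrite det_tuple_mxR intr_eq0.
  by apply/matrixP => i j; rewrite !mxE Yy.
rewrite {1}xb; apply: eq_bigr => i _; rewrite Yy pmulrn gez0_abs //.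
Qed.

Theorem theorem3p2 (R : realType) (d : nat) (M : zset d) :
  affine_monoid M -> positive_monoid M -> gp_full M -> ICP M ->
  (forall x : 'rV[int]_d, M x <-> in_cone R M x) /\
  (forall x : 'rV[int]_d, M x -> f_covered R M x).
Proof.
move=> affM _ gpM icpM.
have coneM x : M x -> in_cone R M x.
  move=> Mx; exists 1, (fun=> x), (fun=> 1); split=> //; split=> //.
  by rewrite big_ord1 scale1r.
split=> x; last by move/coneM; apply: cone_f_covered.
split; first exact: coneM.
move=> /(cone_f_covered affM gpM icpM)[a [y [hilby [_ ->]]]].
by apply: affine_monoid_sum => // i; case: (hilby i).
Qed.
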